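(* Let $P_1,\ldots,P_\ell\in\mathbb{Z}[n]$ with $P_i(0)=0$ for all $1\le i\le\ell$. For every $\varepsilon>0$ there exists $N_0=N_0(\varepsilon,P_1,\ldots,P_\ell)$ such that if $N\ge N_0$ and $A\subseteq[1,N]$, then there exists $n\in\mathbb{N}$ such that $$\frac{|A\cap(A+P_i(n))|}{N}>\left(\frac{|A|}{N}\right)^2-\varepsilon\qquad\text{for all }1\le i\le\ell.$$
   Context: $[1,N]=\{1,\ldots,N\}$, $\mathbb{N}=\{1,2,3,\ldots\}$, and $A+s=\{a+s: a\in A\}\subseteq\mathbb{Z}$. The polynomials may have different degrees. *)

(* Defs.v *)
From mathcomp Require Import all_boot all_order all_algebra finmap.

Set Implicit Arguments.
Unset Strict Implicit.
Unset Printing Implicit Defensive.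

Import GRing.Theory.
Local Open Scope fset_scope.
Local Open Scope ring_scope.

Definition shift (A : {fset int}) (s : int) : {fset int} :=
  [fset a + s | a in A].

Definition int_interval (N : nat) : {fset int} :=
  [fset n.+1%:Z | n in iota 0 N].

Lemma mem_shift (A : {fset int}) (s x : int) :
  (x \in shift A s) = (x - s \in A).
Proof.
apply/imfsetP/idP => [[a aA ->]|xA]; first by rewrite addrK.
by exists (x - s); rewrite //= subrK.
Qed.

Lemma mem_int_interval (N : nat) (x : int) :
  (x \in int_interval N) = (1 <= x <= N%:Z).
Proof.
apply/imfsetP/andP => /= [[n + ->]|].
  by rewrite mem_iota add0n => /andP[_ nN]; split; rewrite lez_nat.
case: x => [[|n]|n] [] // _; rewrite lez_nat => nN.
by exists n; rewrite ?mem_iota.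
Qed.

(* Main.v *)
(** Shifting modulo [N], the correlation [|A cap (A + m)| / N] differs by at
    most [|m| / N] from [sum_x w_x cos (2 pi m x / N)], where
    [w_x = |1_A^(x)|^2 >= 0] has total mass at most 1 and [w_0 = (|A| / N)^2].
    So it suffices to find, for every finite measure [w] of mass at most 1 on the
    circle, some [n >= 1], bounded independently of [w], making every
    [sum_y w_y cos (2 pi P_i(n) th_y)] larger than [- eps].

    Frequencies are split into heavy ones, around which [w] has mass at least
    [tau] at a fine scale [delta]; light ones, around which it has mass less than
    a much smaller [tau'] at a coarser scale [delta']; and the rest.  The heavy
    frequencies cluster around boundedly many points, so polynomial recurrence on
    a torus gives [k <= K] making all [P_i(r x k) th] close to integers,
    whatever the multiplier [x]: their contribution is nonnegative.
    By Weyl's inequality the light contribution is small in mean square over [x],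
    for each [k <= K].  If this fails to produce [n], the remaining frequencies have
    mass at least [eps / 2], so that the heavy mass grows by [eps / 2] on passing
    to [(tau', delta')], which can happen only boundedly often. *)
Require Import Defs.
From mathcomp Require Import all_boot all_order all_algebra finmap reals.
From mathcomp Require Import trigo.
From mathcomp Require Import zify ring lra.

Import Order.TTheory GRing.Theory Num.Theory.
Local Open Scope fset_scope.
Local Open Scope ring_scope.

Set Implicit Arguments.
Unset Strict Implicit.
Unset Printing Implicit Defensive.

(** * Distance to the nearest integer and cosine sums *)

Definition dint {R : realType} (x : R) : R := `|x - (Num.floor (x + 2^-1))%:~R|.

Lemma dint_ge0 (R : realType) (x : R) : 0 <= dint x.
Proof. exact: normr_ge0. Qed.

Lemma dint_le_half (R : realType) (x : R) : dint x <= 2^-1.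
Proof.
rewrite /dint; have := floor_itv (x + 2^-1).
rewrite intrD ler_norml; move: (_%:~R) => m /andP[h1 h2].
by apply/andP; split; lra.
Qed.

(** Any integer other than the rounded value is at distance at least 1 from it, while [x] is within
    1/2 of the rounded value. *)
Lemma dint_le (R : realType) (x : R) (k : int) : dint x <= `|x - k%:~R|.
Proof.
have [->|kN] := eqVneq k (Num.floor (x + 2^-1)); first exact: lexx.
have := dint_le_half x; rewrite /dint; set m := Num.floor _ in kN * => h.
have : 1 <= `|(m - k)%:~R : R|.
  by rewrite -intr_norm ler1z; lia.
rewrite intrB => h1; have := ler_distD x (m%:~R) (k%:~R : R).
by rewrite (distrC _ x); lra.
Qed.

Lemma dintD (R : realType) (x y : R) : dint (x + y) <= dint x + dint y.
Proof.
apply: le_trans (dint_le _ (Num.floor (x + 2^-1) + Num.floor (y + 2^-1))) _.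
by rewrite intrD opprD addrACA ler_normD.
Qed.

Lemma dintMz (R : realType) (k : int) (x : R) :
  dint (k%:~R * x) <= `|k|%:~R * dint x.
Proof.
apply: le_trans (dint_le _ (k * Num.floor (x + 2^-1))) _.
by rewrite intrM -mulrBr normrM intr_norm.
Qed.

Lemma dintMn (R : realType) (n : nat) (x : R) : dint (n%:R * x) <= n%:R * dint x.
Proof. by have := dintMz n x; rewrite -!pmulrn. Qed.

Lemma dint0 (R : realType) : dint 0 = 0 :> R.
Proof.
by apply/eqP; rewrite eq_le dint_ge0 andbT (le_trans (dint_le _ 0)) // subr0 normr0.
Qed.

Lemma dintN (R : realType) (x : R) : dint (- x) = dint x.
Proof.
have aux (y : R) : dint (- y) <= dint y.
  by have := dintMz (-1) y; rewrite mulrN1z mulN1r normrN1 mul1r.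
by apply/eqP; rewrite eq_le aux -{1}[x]opprK aux.
Qed.

Definition cosT {R : realType} (x : R) : R := cos (2 * pi * x).

Definition sinT {R : realType} (x : R) : R := sin (2 * pi * x).

Lemma cosT0 (R : realType) : cosT 0 = 1 :> R.
Proof. by rewrite /cosT mulr0 cos0. Qed.

Lemma cosTN (R : realType) (x : R) : cosT (- x) = cosT x.
Proof. by rewrite /cosT mulrN cosN. Qed.

Lemma cosTB (R : realType) (x y : R) :
  cosT (x - y) = cosT x * cosT y + sinT x * sinT y.
Proof. by rewrite /cosT /sinT mulrBr cosB. Qed.

Lemma cosTM (R : realType) (x y : R) :
  cosT x * cosT y = (cosT (x - y) + cosT (x + y)) / 2.
Proof. by rewrite /cosT (mulrBr _ x) (mulrDr _ x) cosB cosD; field. Qed.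

Lemma cosT_le1 (R : realType) (x : R) : cosT x <= 1.
Proof. exact: cos_le1. Qed.

Lemma cosT_geN1 (R : realType) (x : R) : -1 <= cosT x.
Proof. exact: cos_geN1. Qed.

Lemma cosTDz (R : realType) (x : R) (k : int) : cosT (x + k%:~R) = cosT x.
Proof.
have aux (n : nat) (y : R) : cosT (y + n%:R) = cosT y.
  elim: n y => [|n IH] y; first by rewrite addr0.
  rewrite -natr1 addrA -[RHS]IH /cosT mulrDr mulr1.
  by rewrite (_ : 2 * pi = pi *+ 2 :> R) ?cosD2pi // mulr_natl.
case: k => n; first exact: aux.
by rewrite NegzE mulrNz -[LHS](aux n.+1) subrK.
Qed.

Lemma cosT_ge0 (R : realType) (x : R) : dint x <= 4^-1 -> 0 <= cosT x.
Proof.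
rewrite /dint; set k := Num.floor _ => h.
rewrite -(subrK k%:~R x) cosTDz; move: (x - _) h => y.
rewrite ler_norml => /andP[h1 h2]; apply: cos_ge0_pihalf.
have p0 := pi_gt0 R.
by apply/andP; split; nra.
Qed.

(* [2 sin(pi a) cos(2 pi (a n + b))] telescopes. *)
Lemma cosT_sum (R : realType) (a b : R) (M : nat) :
  2 * sin (pi * a) * (\sum_(n < M) cosT (a * n%:R + b)) =
  sinT (a * M%:R + b - a / 2) - sinT (b - a / 2).
Proof.
elim: M => [|M IH]; first by rewrite big_ord0 mulr0 mulr0 add0r subrr.
rewrite big_ord_recr /= mulrDr IH (_ : M.+1%:R = M%:R + 1); last by rewrite natr1.
rewrite /sinT /cosT.
rewrite (_ : 2 * pi * (a * (M%:R + 1) + b - a / 2) =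
  2 * pi * (a * M%:R + b) + pi * a); last by field.
rewrite (_ : 2 * pi * (a * M%:R + b - a / 2) =
  2 * pi * (a * M%:R + b) - pi * a); last by field.
by rewrite sinB sinD; ring.
Qed.

(** Both sides are nonnegative with square [(1 - cosT a) / 2], because [cosT] is even and has period
    1. *)
Lemma sin_pi_dint (R : realType) (a : R) : `|sin (pi * a)| = sin (pi * dint a).
Proof.
have h1 : sin (pi * a) ^+ 2 = (1 - cosT a) / 2.
  have -> : cosT a = cos ((pi * a) *+ 2) by rewrite /cosT -mulr_natl; congr cos; ring.
  by rewrite cos_mulr2n cos2sin2 -mulr_natl; field.
have h2 (x : R) : cosT `|x| = cosT x.
  by case: (ger0P x) => // _; rewrite cosTN.
have h3 : sin (pi * dint a) ^+ 2 = (1 - cosT a) / 2.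
  have -> : cosT a = cosT (dint a).
    by rewrite /dint h2 -[in LHS](subrK (Num.floor (a + 2^-1))%:~R a) cosTDz.
  have -> : cosT (dint a) = cos ((pi * dint a) *+ 2).
    by rewrite /cosT -mulr_natl; congr cos; ring.
  by rewrite cos_mulr2n cos2sin2 -mulr_natl; field.
have s0 : 0 <= sin (pi * dint a).
  apply: sin_ge0_pi; have := dint_ge0 a; have := dint_le_half a; have := pi_gt0 R.
  by move=> p0 d1 d0; apply/andP; split; nra.
rewrite -(ger0_norm s0); apply/eqP.
by rewrite -(eqrXn2 (n := 2)) // !real_normK ?num_real // h1 h3.
Qed.

(** After multiplication by [2 sin(pi a)] the sum telescopes to something of size at most 2, and
    [|sin(pi a)| >= sin(pi delta)]. The threshold is therefore uniform in [a] and [b]. *)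
Lemma cosT_sum_small (R : realType) (delta eta : R) : 0 < delta -> 0 < eta ->
  exists M0 : nat, forall M : nat, (M0 <= M)%N -> forall a b : R,
    delta <= dint a -> `|\sum_(n < M) cosT (a * n%:R + b)| <= eta * M%:R.
Proof.
move=> d0 e0; have p0 := pi_gt0 R.
have [d1|d1] := leP delta 2^-1; last first.
  by exists 0%N => M _ a b h; have := dint_le_half a; lra.
have k0 : 0 < sin (pi * delta) by apply: sin_gt0_pi; apply/andP; split; nra.
set k := sin _ in k0.
exists (Num.bound (k * eta)^-1) => M hM a b ha.
have hM' : (k * eta)^-1 <= M%:R.
  apply: le_trans (ltW (archi_boundP _)) _; last by rewrite ler_nat.
  by rewrite invr_ge0 ltW // mulr_gt0.
have kle : k <= `|sin (pi * a)|.
  rewrite sin_pi_dint /k.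
  have h := dint_le_half a.
  have [->|dN] := eqVneq delta (dint a); first exact: lexx.
  have dl : delta < dint a by rewrite lt_neqAle dN.
  apply: ltW; rewrite ltr_sin ?in_itv /=; last 2 first.
  - by apply/andP; split; nra.
  - by apply/andP; split; nra.
  by rewrite ltr_pM2l.
set S := \sum_(_ < _) _.
have hS : 2 * (k * `|S|) <= 2.
  apply: (@le_trans _ _ (`|2 * sin (pi * a) * S|)).
    rewrite !normrM ger0_norm ?ler0n // -mulrA ler_wpM2l ?ler0n //.
    by rewrite ler_wpM2r.
  rewrite /S cosT_sum; apply: le_trans (ler_normB _ _) _.
  by have := lerD (sin_max (2 * pi * (a * M%:R + b - a / 2)))
    (sin_max (2 * pi * (b - a / 2))).
have : 1 <= k * (eta * M%:R).
  have := ler_wpM2l (ltW (mulr_gt0 k0 e0)) hM'.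
  by rewrite mulfV ?gt_eqF ?mulr_gt0 // mulrA.
by move=> h2; rewrite -(ler_pM2l k0); lra.
Qed.

(** * Polynomial phases and Weyl's inequality *)

(* [f] is a polynomial function of degree at most [d] whose coefficient of degree
   [d] is [a], expressed through iterated differences. *)
Fixpoint pdeg {R : realType} (d : nat) (a : R) (f : nat -> R) : Prop :=
  if d is d'.+1 then
    forall h : nat, pdeg d' (d%:R * h%:R * a) (fun n => f (n + h)%N - f n)
  else forall n, f n = a.

Lemma eq_pdeg (R : realType) (d : nat) (a b : R) (f g : nat -> R) :
  f =1 g -> a = b -> pdeg d a f -> pdeg d b g.
Proof.
elim: d a b f g => [|d IH] a b f g fg ab /= H; first by move=> n; rewrite -fg -ab.
by move=> h; apply: IH (H h) => [n|]; rewrite ?fg ?ab.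
Qed.

Lemma pdegD (R : realType) (d : nat) (a b : R) (f g : nat -> R) :
  pdeg d a f -> pdeg d b g -> pdeg d (a + b) (fun n => f n + g n).
Proof.
elim: d a b f g => [|d IH] a b f g /= Hf Hg; first by move=> n; rewrite Hf Hg.
move=> h; apply: eq_pdeg (IH _ _ _ _ (Hf h) (Hg h)) => [n|] /=; last by rewrite mulrDr.
by rewrite opprD addrACA.
Qed.

Lemma pdegZ (R : realType) (d : nat) (c a : R) (f : nat -> R) :
  pdeg d a f -> pdeg d (c * a) (fun n => c * f n).
Proof.
elim: d a f => [|d IH] a f /= Hf; first by move=> n; rewrite Hf.
move=> h; apply: eq_pdeg (IH _ _ (Hf h)) => [n|] /=; last by rewrite mulrCA.
by rewrite mulrBr.
Qed.

Lemma pdeg_shift (R : realType) (d : nat) (a : R) (f : nat -> R) (s : nat) :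
  pdeg d a f -> pdeg d a (fun n => f (n + s)%N).
Proof.
elim: d a f => [|d IH] a f /= Hf; first by move=> n; rewrite Hf.
by move=> h; apply: eq_pdeg (IH _ _ (Hf h)) => [n|] //=; rewrite addnAC.
Qed.

Lemma pdeg0 (R : realType) (d : nat) : pdeg d 0 (fun _ => 0 : R).
Proof.
elim: d => [|d IH] //= h.
by apply: eq_pdeg IH => [n|]; rewrite ?subrr ?mulr0.
Qed.

Lemma pdeg_const (R : realType) (d : nat) (c : R) : pdeg d.+1 0 (fun _ => c).
Proof. by move=> h; apply: eq_pdeg (pdeg0 _ d) => [n|]; rewrite ?subrr ?mulr0. Qed.

(** Discrete product rule: the difference by [h] is [r n (g(n+h) - g(n)) + r h g(n+h)]. Induction
    handles the first summand, shift and scaling the second. *)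
Lemma pdeg_mulX (R : realType) (d : nat) (r a : R) (g : nat -> R) :
  pdeg d a g -> pdeg d.+1 (r * a) (fun n => r * n%:R * g n).
Proof.
elim: d a g => [|d IH] a g Hg h.
  by move=> n; rewrite !Hg natrD; ring.
have H1 := pdegD (IH _ _ (Hg h)) (pdegZ (r * h%:R) (pdeg_shift h Hg)).
apply: eq_pdeg H1 => [n|] /=; first by rewrite natrD; ring.
by rewrite -[d.+2]addn1 natrD; ring.
Qed.

(** Induction along Horner's scheme. [d] may exceed the degree of [p], the coefficient then being 0;
    this lets polynomials of different degrees share one [d]. *)
Lemma pdeg_horner (R : realType) (p : {poly int}) (d r : nat) (al : R) :
  (size p <= d.+1)%N ->
  pdeg d ((p`_d)%:~R * r%:R ^+ d * al) (fun n => (p.[(r * n)%N%:Z])%:~R * al).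
Proof.
elim/poly_ind: p d => [|p c IH] d.
  by move=> _; apply: eq_pdeg (pdeg0 _ d) => [n|]; rewrite ?horner0 ?coef0 !mul0r.
rewrite size_MXaddC => sp.
have pE n : ((p * 'X + c%:P).[(r * n)%N%:Z])%:~R * al =
    r%:R * n%:R * ((p.[(r * n)%N%:Z])%:~R * al) + c%:~R * al.
  by rewrite hornerMXaddC intrD intrM -pmulrn natrM; ring.
case: d sp => [|d] sp.
  have p0 : p = 0.
    have [//|pN] := eqVneq p 0.
    by move: sp; rewrite (negbTE pN) /= ltnS leqn0 size_poly_eq0 (negbTE pN).
  by move=> n; rewrite p0 mul0r add0r hornerC coefC /= expr0 mulr1.
have sp' : (size p <= d.+1)%N.
  by move: sp; case: eqP => [->|_]; rewrite ?size_poly0.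
have H1 := pdegD (pdeg_mulX r%:R (IH _ sp')) (pdeg_const d (c%:~R * al)).
apply: eq_pdeg H1 => [n|]; first by rewrite pE.
by rewrite coefD coefMX coefC /= !addr0 exprS; ring.
Qed.

Lemma pdegBc (R : realType) (d : nat) (a c : R) (f : nat -> R) :
  pdeg d a f -> exists b, pdeg d b (fun n => f n - c).
Proof.
case: d => [|d] H; first by exists (a - c) => n; rewrite H.
by exists (a + 0); apply: (pdegD H); apply: pdeg_const.
Qed.

Lemma sqr_sum_le (R : realType) (M : nat) (x : 'I_M -> R) :
  (\sum_n x n) ^+ 2 <= M%:R * \sum_n x n ^+ 2.
Proof.
rewrite expr2 mulr_suml.
apply: (@le_trans _ _ (\sum_i \sum_j (x i ^+ 2 + x j ^+ 2) / 2)).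
  apply: ler_sum => i _; rewrite mulr_sumr; apply: ler_sum => j _.
  by have := sqr_ge0 (x i - x j); rewrite sqrrB -mulr_natl; lra.
rewrite le_eqVlt; apply/orP; left; apply/eqP.
under eq_bigr do rewrite -mulr_suml big_split /= sumr_const card_ord.
rewrite -mulr_suml big_split /= sumr_const card_ord sumrMnl -mulr2n.
by rewrite -[_ *+ 2]mulr_natl -[_ *+ M]mulr_natl; field.
Qed.

(** Each shift by one trades a single boundary term for another. *)
Lemma norm_sum_shift_le (R : realType) (g : nat -> R) (M h : nat) :
  (forall n, `|g n| <= 1) ->
  `|\sum_(n < M) g n - \sum_(n < M) g (n + h)%N| <= 2 * h%:R.
Proof.
move=> g1; elim: h => [|h IH].
  under [X in _ - X]eq_bigr do rewrite addn0.
  by rewrite subrr normr0 mulr0.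
have E : \sum_(n < M) g (n + h)%N - \sum_(n < M) g (n + h.+1)%N = g h - g (M + h)%N.
  elim: M {IH} => [|M IHM]; first by rewrite !big_ord0 subrr add0n subrr.
  rewrite !big_ord_recr /= opprD addrACA IHM.
  by rewrite addnS addSn; ring.
rewrite (_ : h.+1%:R = h%:R + 1); last by rewrite natr1.
rewrite mulrDr.
rewrite -(subrK (\sum_(n < M) g (n + h)%N) (\sum_(n < M) g n)) -addrA E.
apply: le_trans (ler_normD _ _) (lerD IH _).
by apply: le_trans (ler_normB _ _) _; rewrite mulr1 lerD.
Qed.

Lemma norm_cosT_le1 (R : realType) (x : R) : `|cosT x| <= 1.
Proof. exact: cos_max. Qed.

(** The right side is the squared modulus of an exponential sum: the square of the cosine sum plus
    that of the sine sum. *)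
Lemma sqr_sum_cosT_le (R : realType) (I : finType) (w x : I -> R) :
  (\sum_i w i * cosT (x i)) ^+ 2 <= \sum_i \sum_j w i * w j * cosT (x i - x j).
Proof.
have -> : \sum_i \sum_j w i * w j * cosT (x i - x j) =
    (\sum_i w i * cosT (x i)) ^+ 2 + (\sum_i w i * sinT (x i)) ^+ 2.
  rewrite !expr2 !mulr_suml -big_split; apply: eq_bigr => i _ /=.
  rewrite !mulr_sumr -big_split; apply: eq_bigr => j _ /=.
  by rewrite cosTB; ring.
by rewrite lerDl sqr_ge0.
Qed.

(** Averaging over [H] shifts costs the boundary error [2 * H]. Cauchy-Schwarz in [n] leaves
    correlations of pairs of shifts: the hypothesis bounds those with [h != k], and the diagonal
    ones are absorbed because [H] is at least [2 / eps ^+ 2]. *)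
Lemma van_der_corput (R : realType) (f : nat -> R) (M H : nat) (eta eps : R) :
  0 < eps -> 2 / eps ^+ 2 <= H%:R -> eta <= eps ^+ 2 / 2 ->
  (forall h k : 'I_H, h != k ->
     `|\sum_(n < M) cosT (f (n + h)%N - f (n + k)%N)| <= eta * M%:R) ->
  `|\sum_(n < M) cosT (f n)| <= eps * M%:R + 2 * H%:R.
Proof.
move=> e0 hH he hS.
have H0 : 0 < H%:R :> R by apply: lt_le_trans hH; rewrite divr_gt0 ?exprn_gt0.
set S := \sum_(n < M) cosT (f n).
pose T := \sum_(n < M) \sum_(h < H) cosT (f (n + h)%N).
have ST : `|H%:R * S - T| <= 2 * H%:R * H%:R.
  rewrite /T exchange_big /= -[H in H%:R * S]card_ord mulr_natl -sumr_const -sumrB.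
  apply: le_trans (ler_norm_sum _ _ _) _.
  apply: (@le_trans _ _ (\sum_(h < H) 2 * H%:R)); last first.
    by rewrite sumr_const card_ord -[_ *+ H]mulr_natr.
  apply: ler_sum => h _.
  apply: le_trans (norm_sum_shift_le (g := fun n => cosT (f n)) _ _ _) _.
    by move=> n; exact: norm_cosT_le1.
  by rewrite ler_wpM2l // ler_nat ltnW.
have T2 : T ^+ 2 <= (eps * M%:R * H%:R) ^+ 2.
  apply: le_trans (sqr_sum_le _) _.
  apply: (@le_trans _ _ (M%:R * \sum_(n < M) \sum_(h < H) \sum_(k < H)
      cosT (f (n + h)%N - f (n + k)%N))).
    apply: ler_wpM2l => //; apply: ler_sum => n _.
    have := sqr_sum_cosT_le (fun _ => 1) (fun h : 'I_H => f (n + h)%N).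
    under eq_bigr do rewrite mul1r.
    move/le_trans; apply; rewrite le_eqVlt; apply/orP; left; apply/eqP.
    by apply: eq_bigr => h _; apply: eq_bigr => k _; rewrite !mul1r.
  rewrite (_ : (eps * M%:R * H%:R) ^+ 2 =
    M%:R * (eps ^+ 2 * M%:R * H%:R * H%:R)); last by ring.
  apply: ler_wpM2l => //.
  rewrite exchange_big /=.
  under eq_bigr do rewrite exchange_big /=.
  have b1 : eps ^+ 2 / 2 * H%:R >= 1.
    have := ler_wpM2l (ltW (divr_gt0 (exprn_gt0 2 e0) (ltr0n R 2))) hH.
    by rewrite (_ : eps ^+ 2 / 2 * (2 / eps ^+ 2) = 1) //; field; rewrite gt_eqF.
  apply: (@le_trans _ _ (\sum_(h < H)
      (M%:R * (eps ^+ 2 / 2 * H%:R) + H%:R * (eps ^+ 2 / 2 * M%:R)))); last first.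
    rewrite sumr_const card_ord -mulr_natl le_eqVlt.
    by apply/orP; left; apply/eqP; field.
  apply: ler_sum => h _; rewrite (bigD1 h) //=; apply: lerD.
    under eq_bigr do rewrite subrr cosT0.
    by rewrite sumr_const card_ord ler_peMr.
  apply: (@le_trans _ _ (\sum_(k < H | k != h) eps ^+ 2 / 2 * M%:R)).
    apply: ler_sum => k kh; apply: le_trans (ler_norm _) _.
    apply: le_trans (hS h k _) _; first by rewrite eq_sym.
    by apply: ler_wpM2r.
  rewrite mulr_natl -[X in _ <= _ *+ X](@card_ord H) -sumr_const.
  rewrite [X in _ <= X](bigID (fun k => k != h)) /= lerDl sumr_ge0 // => *.
  by rewrite mulr_ge0 // divr_ge0 // sqr_ge0.
have T1 : `|T| <= eps * M%:R * H%:R.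
  rewrite -(@ler_pXn2r _ 2) ?nnegrE ?normr_ge0 //; last by rewrite !mulr_ge0 // ltW.
  by rewrite real_normK ?num_real.
rewrite -(ler_pM2l H0) mulrDr.
have -> : H%:R * `|S| = `|H%:R * S| by rewrite normrM ger0_norm // ltW.
have := ler_normD (H%:R * S - T) T; rewrite subrK; lra.
Qed.

(** By van der Corput, a large sum forces a large sum for some difference of two shifts of [f],
    which has lower degree and leading coefficient a multiple of [a]. [Q] is fixed before [delta],
    so that a modulus can later be chosen before the scale. *)
Lemma weyl (R : realType) (d : nat) (eta : R) : 0 < eta ->
  exists Q : nat, forall delta : R, 0 < delta ->
  exists M0 : nat, forall M : nat, (M0 <= M)%N ->
  forall (a : R) (f : nat -> R), pdeg d.+1 a f ->
    `|\sum_(n < M) cosT (f n)| <= eta * M%:R \/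
    exists q : nat, (0 < q <= Q)%N /\ dint (q%:R * a) < delta.
Proof.
elim: d eta => [|d IH] eta e0.
  exists 1%N => delta d0; have [M0 hM0] := cosT_sum_small d0 e0.
  exists M0 => M hM a f Hf.
  have fE n : f n = a * n%:R + f 0%N.
    by have := Hf n 0%N => /=; rewrite add0n mul1r => /eqP; rewrite subr_eq mulrC => /eqP.
  have [h|h] := leP delta (dint a); last by right; exists 1%N; rewrite mul1r.
  by left; under eq_bigr do rewrite fE; exact: hM0.
pose eps := eta / 2; have eps0 : 0 < eps by rewrite divr_gt0.
pose eta1 := eps ^+ 2 / 2; have eta10 : 0 < eta1 by rewrite divr_gt0 ?exprn_gt0.
have [Q hQ] := IH _ eta10.
pose H := Num.bound (2 / eps ^+ 2).
have hH : 2 / eps ^+ 2 <= H%:R.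
  by apply/ltW/archi_boundP; rewrite divr_ge0 // sqr_ge0.
(* The [q] found for the difference is multiplied by [d.+2 * (h1 - k1)], where [h1 - k1 <= H]. *)
exists (Q * (d.+2 * H))%N => delta d0; have [M0 hM0] := hQ _ d0.
(* The second threshold makes the boundary error [2 * H] at most [eps * M]. *)
exists (maxn M0 (Num.bound (2 * H%:R / eps))) => M.
rewrite geq_max => /andP[hM hM'] a f Hf.
have hM2 : 2 * H%:R <= eps * M%:R.
  rewrite (mulrC eps) -ler_pdivrMr //; apply: le_trans (ltW (archi_boundP _)) _.
    by apply: divr_ge0; [exact: mulr_ge0|exact: ltW].
  by rewrite ler_nat.
case: (boolP [forall h : 'I_H, forall k : 'I_H, (h != k) ==>
   (`|\sum_(n < M) cosT (f (n + h)%N - f (n + k)%N)| <= eta1 * M%:R)]) => [hS|].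
  left; apply: le_trans (@van_der_corput _ _ _ H eta1 eps _ _ _ _) _ => //.
    by move=> h k hk; move/forallP/(_ h)/forallP/(_ k)/implyP: hS; apply.
  by rewrite /eps in hM2 *; lra.
rewrite negb_forall => /existsP[h]; rewrite negb_forall => /existsP[k].
rewrite negb_imply => /andP[hk hS]; right.
have {hk hS} [h1 [k1 [kh hH1 hS]]] : exists h1 k1 : nat, [/\ (k1 < h1)%N, (h1 < H)%N &
    ~~ (`|\sum_(n < M) cosT (f (n + h1)%N - f (n + k1)%N)| <= eta1 * M%:R)].
  case: (ltngtP h k) => [hk'|hk'|hk']; last by rewrite (ord_inj hk') eqxx in hk.
    exists k, h; split => //; move: hS; congr (~~ (`| _ | <= _)).
    by apply: eq_bigr => n _; rewrite -cosTN opprB.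
  by exists h, k.
have Hf1 : pdeg d.+1 (d.+2%:R * (h1 - k1)%:R * a) (fun n => f (n + (h1 - k1))%N - f n).
  exact: Hf.
have [|[q [/andP[q0 qQ] hq]]] := hM0 M hM _ _ (pdeg_shift k1 Hf1).
  move=> hS'; case/negP: hS; move: hS'; congr (`| _ | <= _).
  by apply: eq_bigr => n _; rewrite -addnA subnKC // ltnW.
exists (q * (d.+2 * (h1 - k1)))%N; split; last first.
  by rewrite !natrM; move: hq; congr (dint _ < _); ring.
rewrite !muln_gt0 q0 subn_gt0 kh /= leq_mul // leq_mul2l /=.
by rewrite leq_subLR (leq_trans (ltnW hH1)) // leq_addl.
Qed.

(** * Polynomial recurrence on a torus *)

(** Dirichlet's argument: cut the torus into at most [m.+1 ^ J] boxes of side below [eta]; among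
    [m.+1 ^ J + 1] times two share a box. *)
Lemma dint_pigeonhole (R : realType) (J : nat) (eta : R) : 0 < eta ->
  exists r : nat, forall I : finType, (#|I| <= J)%N -> forall F : I -> nat -> R,
  exists k t : nat, (k < t <= r)%N /\ forall j, dint (F j t - F j k) < eta.
Proof.
move=> e0; pose m := Num.bound eta^-1.
have hm : eta^-1 < m.+1%:R.
  apply: (@lt_trans _ _ m%:R); last by rewrite ltr_nat.
  by apply: archi_boundP; rewrite invr_ge0 ltW.
pose fr (x : R) := x - (Num.floor x)%:~R.
have fr_itv x : 0 <= fr x < 1.
  by rewrite /fr; have := floor_itv x; rewrite intrD; lra.
pose cl (x : R) : 'I_m.+1 := inord (Num.truncn (m.+1%:R * fr x)).
have clP x : (cl x)%:R <= m.+1%:R * fr x < (cl x)%:R + 1.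
  have /andP[f0 f1] := fr_itv x.
  have f0' : 0 <= m.+1%:R * fr x by rewrite mulr_ge0.
  have := truncn_itv f0'; rewrite /cl inordK ?natr1 //.
  by rewrite truncn_lt_nat // -[X in _ < X]mulr1 ltr_pM2l.
have cl_dint x y : cl x = cl y -> dint (x - y) < eta.
  move=> cxy; apply: le_lt_trans (dint_le _ (Num.floor x - Num.floor y)) _.
  rewrite intrB (_ : x - y - _ = fr x - fr y); last by rewrite /fr; ring.
  have := clP x; have := clP y; rewrite cxy => /andP[h1 h2] /andP[h3 h4].
  have m0 : 0 < m.+1%:R :> R by rewrite ltr0n.
  rewrite -(ltr_pM2l m0) -[X in X * `|_|](ger0_norm (ltW m0)) -normrM mulrBr.
  apply: (@lt_trans _ _ 1); first by rewrite ltr_norml; lra.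
  by rewrite mulrC -ltr_pdivrMl // mulr1.
exists (m.+1 ^ J)%N => I cI F.
pose G (t : 'I_(m.+1 ^ J).+1) : {ffun I -> 'I_m.+1} := [ffun j => cl (F j t)].
have : ~~ injectiveb G.
  apply/injectiveP => /leq_card; rewrite card_ffun !card_ord.
  by rewrite leqNgt ltnS leq_pexp2l.
move/injectivePn => [x [y xy Gxy]].
have Gj j : cl (F j x) = cl (F j y).
  by have := congr1 (fun g : {ffun I -> 'I_m.+1} => g j) Gxy; rewrite !ffunE.
case: (ltngtP x y) => [h|h|h]; last by rewrite (ord_inj h) eqxx in xy.
  exists x, y; split; first by rewrite h -ltnS ltn_ord.
  by move=> j; apply: cl_dint; rewrite Gj.
exists y, x; split; first by rewrite h -ltnS ltn_ord.
by move=> j; apply: cl_dint; rewrite Gj.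
Qed.

(* Choosing the increments of [S] successively, each one a recurrence time for
   the lower degree functions [D_x f], makes [f] almost additive along [S]; then
   pigeonhole the sums of the [f (S u.+1 - S u)]. *)
Lemma polynomial_recurrence (R : realType) (d J : nat) (eta : R) : 0 < eta ->
  exists K : nat, forall I : finType, (#|I| <= J)%N ->
  forall f : I -> nat -> R,
    (forall j, f j 0%N = 0 /\ exists a, pdeg d a (f j)) ->
  exists k : nat, (0 < k <= K)%N /\ forall j, dint (f j k) < eta.
Proof.
elim: d J eta => [|d IH] J eta e0.
  exists 1%N => I _ f Hf; exists 1%N; split => // j.
  by have [h0 [a ha]] := Hf j; rewrite ha -(ha 0%N) h0 dint0.
have e2 : 0 < eta / 2 by rewrite divr_gt0.
have [r Hr] := dint_pigeonhole J e2.
(* At most [r] additivity errors accumulate, using half of [eta]; the pigeonhole uses the other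
   half. *)
pose eta1 := eta / 2 / r.+1%:R.
have e1 : 0 < eta1 by rewrite divr_gt0.
(* One lower degree function for each [j] and each index [k <= r] of an earlier point of [S]. *)
have [K HK] := IH (J * r.+1)%N _ e1.
(* The return time [S t - S k] is a sum of at most [r] increments, each at most [K]. *)
exists (r * K)%N => I cI f Hf.
have step i : (i <= r)%N -> exists S : nat -> nat, S 0%N = 0%N /\
    forall t, (t < i)%N -> (0 < S t.+1 - S t <= K)%N /\
    forall j (k : nat), (k <= t)%N ->
      dint (f j (S t.+1 - S k)%N - f j (S t - S k)%N - f j (S t.+1 - S t)%N) < eta1.
  elim: i => [|i IHi] ir; first by exists (fun=> 0%N).
  have [S [S0 HS]] := IHi (ltnW ir).
  pose x (k : nat) := (S i - S k)%N.
  have [||n [/andP[n0 nK] Hn]] := HK (I * 'I_r.+1)%type _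
     (fun jk n => f jk.1 (n + x jk.2)%N - f jk.1 n - f jk.1 (x jk.2)).
  - by rewrite card_prod card_ord leq_mul2r cI orbT.
  - move=> [j k] /=; have [f0 [a Ha]] := Hf j; split.
      by rewrite add0n f0 subr0 subrr.
    exact: pdegBc (Ha (x k)).
  exists (fun t => if (t <= i)%N then S t else S i + n)%N; split => // t.
  move=> ti1; have [->|ti] : t = i \/ (t < i)%N by lia.
  2:{ rewrite (ltnW ti) ti; have [h1 h2] := HS t ti; split => // j k kt.
    by rewrite (leq_trans kt (ltnW ti)); exact: h2. }
  rewrite leqnn ltnn addKn n0 nK; split => // j k ki; rewrite ki.
  have mono : forall a, (a <= i)%N -> (S (i - a)%N <= S i)%N.
    elim=> [|a IHa] ai; first by rewrite subn0.
    apply: leq_trans (IHa (ltnW ai)).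
    have [|/andP[h _] _] := HS (i - a.+1)%N; first by lia.
    have -> : (i - a = (i - a.+1).+1)%N by lia.
    by apply: ltnW; rewrite -subn_gt0.
  have Ski : (S k <= S i)%N by rewrite -{1}(subKn ki) mono // leq_subr.
  have kr : (k < r.+1)%N by lia.
  have := Hn (j, Ordinal kr); rewrite /= /x.
  rewrite (_ : (S i + n - S k = n + (S i - S k))%N); last by lia.
  by congr (dint _ < _); ring.
have [S [S0 HS]] := step r (leqnn r).
have [k [t [/andP[kt tr] hkt]]] := Hr I cI
  (fun j t => \sum_(u < t) f j (S u.+1 - S u)%N).
(* Telescoping: each further increment contributes one error below [eta1]. *)
have add_err j u : (k + u <= t)%N ->
  dint (f j (S (k + u) - S k)%N -
    (\sum_(v < (k + u)%N) f j (S v.+1 - S v)%N -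
     \sum_(v < k) f j (S v.+1 - S v)%N)) <= u%:R * eta1.
  elim: u => [|u IHu] ut.
    by rewrite addn0 !subnn (Hf j).1 subrr subr0 dint0 mul0r.
  rewrite addnS in ut *.
  have [|_ h2] := HS (k + u)%N; first by lia.
  have := h2 j k (leq_addr _ _) => h3.
  rewrite big_ord_recr /=.
  have := IHu (ltnW ut); move: (\sum_(v < k) _) (\sum_(v < _) _) h3 => s1 s2 h3 h4.
  rewrite (_ : u.+1%:R = 1 + u%:R); last by rewrite addrC natr1.
  rewrite mulrDl mul1r.
  apply: le_trans (lerD (ltW h3) h4).
  by apply: le_trans (dintD _ _); rewrite le_eqVlt; apply/orP; left; apply/eqP; congr dint; ring.
have Smono u : (k + u <= t)%N -> (u <= S (k + u) - S k <= u * K)%N /\ (S k <= S (k + u))%N.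
  elim: u => [|u IHu] ut; first by rewrite addn0 subnn.
  rewrite addnS in ut *; have [/andP[h1 h2] h3] := IHu (ltnW ut).
  by have [|/andP[h4 h5] _] := HS (k + u)%N; lia.
have [|tk1 _] := Smono (t - k)%N; first by rewrite subnKC // ltnW.
rewrite subnKC in tk1; last exact: ltnW.
exists (S t - S k)%N; split.
  have : ((t - k) * K <= r * K)%N by rewrite leq_mul2r; lia.
  lia.
move=> j; have := add_err j (t - k)%N; rewrite subnKC; last exact: ltnW.
move=> /(_ (leqnn _)) h1; have h2 := hkt j.
have h3 : (t - k)%:R * eta1 <= eta / 2.
  rewrite /eta1 mulrA ler_pdivrMr ?ltr0n // mulrC ler_pM2l // ler_nat; lia.
set A := f j _ in h1 *; set B := \sum_(v < t) _ - _ in h1 h2.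
have := dintD (A - B) B; rewrite subrK; lra.
Qed.

(** * Heavy and light frequencies *)

(** Frequencies are compared after multiplication by [r], so for [r > 0] the ball surrounds all
    translates of [th x] by multiples of [1 / r]. Weyl's inequality detects a frequency only up to
    such rationals. *)
Definition ball_mass {R : realType} {T : finType} (w th : T -> R) (r : nat)
    (delta : R) (x : T) : R :=
  \sum_(y | dint (r%:R * (th y - th x)) < delta) w y.

Definition heavy {R : realType} {T : finType} (w th : T -> R) (r : nat)
    (delta tau : R) : {set T} :=
  [set x | tau <= ball_mass w th r delta x].

(** Take a maximal set of heavy points that is separated by [2 * delta]. Its balls of radius [delta]
    are disjoint and have mass at least [tau] each, which bounds their number; maximality gives the
    covering. *)
Lemma heavy_packing (R : realType) (T : finType) (w th : T -> R) (r : nat)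
    (delta tau : R) :
  (forall y, 0 <= w y) -> \sum_y w y <= 1 -> 0 < delta ->
  exists S : {set T}, #|S|%:R * tau <= 1 /\
    forall x, x \in heavy w th r delta tau ->
    exists2 s, s \in S & dint (r%:R * (th x - th s)) < 2 * delta.
Proof.
move=> w0 w1 d0; set H := heavy _ _ _ _ _.
pose sep := fun S : {set T} => (S \subset H) &&
  [forall s in S, forall t in S, (s != t) ==>
  (2 * delta <= dint (r%:R * (th s - th t)))].
have [|S /maxsetP[/andP[SH /forall_inP Ssep] Smax] _] := @maxset_exists T sep set0.
  by rewrite /sep sub0set; apply/forall_inP => s; rewrite in_set0.
have {}Ssep s t : s \in S -> t \in S -> s != t ->
    2 * delta <= dint (r%:R * (th s - th t)).
  by move=> sS tS st; move/forall_inP/(_ t tS)/implyP: (Ssep s sS); apply.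
exists S; split.
  apply: le_trans w1.
  rewrite mulr_natl -sumr_const.
  apply: (@le_trans _ _ (\sum_(s in S) ball_mass w th r delta s)).
    by apply: ler_sum => s /(subsetP SH); rewrite inE.
  rewrite /ball_mass (exchange_big_dep predT) //=.
  apply: ler_sum => y _; rewrite sumr_const.
  set C := #|_|; suff h : (C <= 1)%N.
    by case: (C) h => [|[|//]] _; rewrite ?mulr0n ?mulr1n.
  apply/card_le1_eqP => s t; rewrite !unfold_in => /andP[sS hs] /andP[tS ht].
  have [//|st] := eqVneq s t.
  have := Ssep s t sS tS st.
  have := dintD (r%:R * (th y - th t)) (- (r%:R * (th y - th s))).
  rewrite dintN (_ : _ - _ = r%:R * (th s - th t)); last by ring.
  by move=> *; exfalso; lra.
move=> x xH; have [xS|xS] := boolP (x \in S).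
  by exists x; rewrite // subrr mulr0 dint0 mulr_gt0.
case: (boolP [exists s in S, dint (r%:R * (th x - th s)) < 2 * delta]) => [/exists_inP[s]|].
  by exists s.
rewrite negb_exists => /forallP hx.
have {}hx s : s \in S -> 2 * delta <= dint (r%:R * (th x - th s)).
  by move=> sS; have := hx s; rewrite sS /= -leNgt.
case/negP: xS; rewrite -(Smax (x |: S)) ?setU11 ?subsetUr //.
rewrite /sep subUset sub1set xH SH /=.
apply/forall_inP => s; rewrite !inE => sS; apply/forall_inP => t; rewrite !inE => tS.
apply/implyP => st; case/orP: sS => [/eqP sx|sS]; case/orP: tS => [/eqP tx|tS].
- by move: st; rewrite sx tx eqxx.
- by rewrite sx; exact: hx.
- by rewrite tx -dintN -mulrN opprB; exact: hx.
- exact: Ssep.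
Qed.

(** Expand the square and sum over [x] first. Pairs of frequencies that are far apart cancel up to
    [eta * X]; for light [z], the [y] near [z] have mass below [tau] and are bounded trivially. *)
Lemma light_second_moment (R : realType) (T : finType) (w th : T -> R) (r X : nat)
    (delta tau eta : R) (f : nat -> int) :
  (forall y, 0 <= w y) -> \sum_y w y <= 1 -> 0 <= tau -> 0 <= eta ->
  (forall al : R, `|\sum_(x < X) cosT ((f x)%:~R * al)| <= eta * X%:R \/
     dint (r%:R * al) < delta) ->
  \sum_(x < X) (\sum_(y in ~: heavy w th r delta tau) w y * cosT ((f x)%:~R * th y)) ^+ 2
    <= X%:R * (eta + tau).
Proof.
move=> w0 w1 t0 e0 hf.
pose v y := if y \in ~: heavy w th r delta tau then w y else 0.
have v0 y : 0 <= v y by rewrite /v; case: ifP.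
have vw y : v y <= w y by rewrite /v; case: ifP.
have v1 : \sum_y v y <= 1 by apply: le_trans w1; apply: ler_sum.
have X0 : 0 <= X%:R :> R by [].
apply: (@le_trans _ _ (\sum_(x < X) \sum_z \sum_y
    v z * v y * cosT ((f x)%:~R * (th y - th z)))).
  apply: ler_sum => x _.
  rewrite big_mkcond (eq_bigr (fun y => v y * cosT ((f x)%:~R * th y))); last first.
    by move=> y _; rewrite /v; case: ifP; rewrite ?mul0r.
  apply: le_trans (sqr_sum_cosT_le _ _) _.
  rewrite le_eqVlt; apply/orP; left; apply/eqP.
  by apply: eq_bigr => z _; apply: eq_bigr => y _; rewrite -cosTN opprB mulrBr.
rewrite exchange_big /=.
apply: (@le_trans _ _ (\sum_z v z * (X%:R * (eta + tau)))); last first.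
  rewrite -mulr_suml; apply: ler_piMl => //.
  by rewrite mulr_ge0 // addr_ge0.
apply: ler_sum => z _; rewrite exchange_big /=.
have [zL|zL] := boolP (z \in ~: heavy w th r delta tau); last first.
  by rewrite /v (negbTE zL) mul0r big1 // => y _; rewrite big1 // => x _; rewrite !mul0r.
apply: (@le_trans _ _ (\sum_y v z * (v y * (eta * X%:R) +
    (if dint (r%:R * (th y - th z)) < delta then w y else 0) * X%:R))).
  apply: ler_sum => y _.
  under eq_bigr do rewrite -mulrA.
  rewrite -!mulr_sumr; apply: ler_wpM2l => //.
  set C := \sum_(_ < _) _.
  have CX : C <= X%:R.
    apply: (@le_trans _ _ (\sum_(x < X) 1)); last by rewrite sumr_const card_ord.
    by apply: ler_sum => x _; exact: cosT_le1.
  case: ifP => h.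
    apply: (@le_trans _ _ (w y * X%:R)); last by rewrite lerDr !mulr_ge0.
    apply: le_trans (ler_wpM2l (v0 y) CX) _.
    by apply: ler_wpM2r.
  rewrite mul0r addr0; apply: ler_wpM2l => //.
  by case: (hf (th y - th z)) => [h'|]; [exact: le_trans (ler_norm _) h'|rewrite h].
rewrite -mulr_sumr; apply: ler_wpM2l => //.
rewrite big_split /= -!mulr_suml -[X in _ + X * _]big_mkcond /=.
move: zL; rewrite !inE -ltNge /ball_mass => /ltW zL.
rewrite mulrDr (mulrC _ eta) (mulrC _ tau); apply: lerD; last exact: ler_wpM2r.
by apply: ler_piMl => //; rewrite mulr_ge0.
Qed.

(** * The energy increment and its iteration *)

Lemma sub_heavy (R : realType) (T : finType) (w th : T -> R) (r r' : nat)
    (delta delta' tau tau' : R) :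
  (forall y, 0 <= w y) -> tau' <= tau ->
  (forall al : R, dint (r%:R * al) < delta -> dint (r'%:R * al) < delta') ->
  heavy w th r delta tau \subset heavy w th r' delta' tau'.
Proof.
move=> w0 tt h; apply/subsetP => x; rewrite !inE => hx.
apply: le_trans tt (le_trans hx _).
rewrite /ball_mass [X in _ <= X](bigID (fun y => dint (r%:R * (th y - th x)) < delta)) /=.
rewrite [X in _ <= X + _](eq_bigl (fun y => (dint (r%:R * (th y - th x)) < delta))).
  by rewrite lerDl sumr_ge0.
by move=> y; rewrite andbC; case: ltP => //= /h ->.
Qed.

(** The modulus [r'] is a common multiple of all integers that Weyl's inequality can produce: a
    factorial covers every [q <= Q i], and the products run over all [i] and [k]. It does not depend
    on [delta]. *)
Lemma weyl_common_modulus (R : realType) (l : nat) (P : 'I_l -> {poly int})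
    (r K : nat) (eta : R) :
  (forall i, (P i).[0] = 0) -> (forall i, P i != 0) -> (0 < r)%N -> 0 < eta ->
  exists r' : nat, [/\ (0 < r')%N, (r %| r')%N & forall delta : R, 0 < delta ->
    exists X : nat, (0 < X)%N /\ forall (i : 'I_l) (k : 'I_K) (al : R),
      `|\sum_(x < X) cosT ((P i).[(r * k.+1 * x.+1)%N%:Z]%:~R * al)| <= eta * X%:R \/
      dint (r'%:R * al) < delta].
Proof.
move=> P0 PN r0 e0.
(* This is the degree minus one: a nonzero polynomial vanishing at 0 is not constant. *)
pose deg i := (size (P i)).-2.
have sizeP i : size (P i) = (deg i).+2.
  rewrite /deg; have := PN i; rewrite -size_poly_gt0.
  case E : (size (P i)) => [|[|n]] // _.
  have /size_poly1P[c cN Pc] : size (P i) == 1%N by rewrite E.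
  by have := P0 i; rewrite Pc hornerC => c0; rewrite c0 eqxx in cN.
have [Q hQ] := fin_all_exists (fun i => weyl (deg i) e0).
pose c i := absz (P i)`_(deg i).+1.
have c0 i : (0 < c i)%N.
  rewrite absz_gt0; have := PN i; rewrite -lead_coef_eq0 lead_coefE sizeP; exact.
pose F (i : 'I_l) (k : 'I_K) := (c i * (r * k.+1) ^ (deg i).+1 * (Q i)`!)%N.
have F0 i k : (0 < F i k)%N by rewrite /F !muln_gt0 c0 fact_gt0 expn_gt0 muln_gt0 r0.
have G0 i : (0 < \prod_(k < K) F i k)%N by apply: prodn_gt0 => k; exact: F0.
pose r' := (r * \prod_(i < l) \prod_(k < K) F i k)%N.
have r'0 : (0 < r')%N by rewrite /r' muln_gt0 r0 prodn_gt0.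
exists r'; split => // [|delta d0]; first exact: dvdn_mulr.
have rR : 0 < r'%:R :> R by rewrite ltr0n.
(* Passing from Weyl's denominator to its multiple [r'] enlarges the distance by a factor of at most
   [r']. *)
have dw : 0 < delta / r'%:R by rewrite divr_gt0.
have [M0 hM0] := fin_all_exists (fun i => hQ i _ dw).
exists (\max_i M0 i).+1; split => // i k al.
set X := (\max_i M0 i).+1.
have XM : (M0 i <= X)%N by apply: leqW; exact: leq_bigmax.
have pd := pdeg_shift 1 (@pdeg_horner R (P i) (deg i).+1 (r * k.+1) al _).
rewrite sizeP in pd.
have [h|[q [/andP[q0 qQ] h]]] := hM0 i X XM _ _ (pd (leqnn _)); [left|right].
  by move: h; congr (`| _ | <= _); apply: eq_bigr => x _; rewrite addn1.
have : (q * c i * (r * k.+1) ^ (deg i).+1 %| r')%N.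
  apply: (@dvdn_trans (F i k)).
    rewrite -mulnA mulnC /F dvdn_mul // dvdn_fact // q0 //.
  rewrite /r' (bigD1 i) //= (bigD1 k) //=.
  by rewrite -mulnA dvdn_mull // dvdn_mulr.
case/dvdnP => m mE.
have m0 : (0 < m)%N by move: r'0; rewrite mE muln_gt0 => /andP[].
set t := q%:R * _ in h.
have -> : dint (r'%:R * al) = dint (m%:R * t).
  have E : r'%:R = m%:R * q%:R * `|((P i)`_(deg i).+1)%:~R| *
      (r * k.+1)%N%:R ^+ (deg i).+1 :> R.
    rewrite mE natrM (natrM _ (q * _)) (natrM _ q) natrX -intr_norm -abszE -pmulrn.
    by rewrite /c; ring.
  have [s0|s0] := ger0P (((P i)`_(deg i).+1)%:~R : R).
    by congr dint; rewrite E ger0_norm // /t; ring.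
  by rewrite -dintN; congr dint; rewrite E ltr0_norm // /t; ring.
apply: le_lt_trans (dintMn _ _) _.
rewrite (@lt_le_trans _ _ (m%:R * (delta / r'%:R))) //.
  by rewrite ltr_pM2l // ltr0n.
rewrite mulrCA ler_piMr ?(ltW d0) // ler_pdivrMr // mul1r ler_nat.
by apply: dvdn_leq => //; rewrite mE dvdn_mulr.
Qed.

Lemma dvd_horner_int (p : {poly int}) (r m : nat) : p.[0] = 0 ->
  exists z : int, p.[(r * m)%N%:Z] = z * r%:Z.
Proof.
move=> p0; have /factor_theorem[q ->] : root p 0 by apply/eqP.
exists (q.[(r * m)%N%:Z] * m%:Z).
by rewrite hornerM hornerXsubC subr0 PoszM; ring.
Qed.

(** Since [X] divides [p], the value at [r * m] is [z * r] with [|z| <= B], so moving from [y] to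
    its centre [s] costs at most 1/8. Together with the 1/8 at [s] this stays within 1/4, where the
    cosine is nonnegative. *)
Lemma structured_sum_ge0 (R : realType) (T : finType) (w th : T -> R)
    (H S : {set T}) (p : {poly int}) (r m B : nat) (delta : R) :
  (forall y, 0 <= w y) -> p.[0] = 0 -> (0 < r)%N ->
  (absz p.[(r * m)%N%:Z] <= B)%N -> B%:R * (2 * delta) <= 8^-1 ->
  (forall y, y \in H -> exists2 s, s \in S & dint (r%:R * (th y - th s)) < 2 * delta) ->
  (forall s, s \in S -> dint (p.[(r * m)%N%:Z]%:~R * th s) < 8^-1) ->
  0 <= \sum_(y in H) w y * cosT (p.[(r * m)%N%:Z]%:~R * th y).
Proof.
move=> w0 p0 r0 pB Bd HS hS; apply: sumr_ge0 => y /HS[s sS ys].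
apply: mulr_ge0 => //; apply: cosT_ge0.
have [z zE] := dvd_horner_int r m p0.
have zB : `|z|%:~R <= B%:R :> R.
  rewrite pmulrn ler_int; apply: le_trans (_ : `|p.[(r * m)%N%:Z]| <= _); last first.
    by rewrite -abszE lez_nat.
  by rewrite zE normrM; apply: ler_peMr => //; rewrite ger0_norm lez_nat.
have h1 : dint (p.[(r * m)%N%:Z]%:~R * (th y - th s)) <= 8^-1.
  rewrite zE intrM -mulrA; apply: le_trans (dintMz _ _) _.
  apply: le_trans Bd; apply: ler_pM; rewrite ?ler0z ?dint_ge0 //.
  by rewrite -pmulrn ltW.
have := dintD (p.[(r * m)%N%:Z]%:~R * (th y - th s)) (p.[(r * m)%N%:Z]%:~R * th s).
rewrite -mulrDr subrK; have := hS s sS; lra.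
Qed.

Lemma sum_cosT_ge (R : realType) (T : finType) (w x : T -> R) (A : {set T}) :
  (forall y, 0 <= w y) -> - \sum_(y in A) w y <= \sum_(y in A) w y * cosT (x y).
Proof.
move=> w0; rewrite -sumrN; apply: ler_sum => y _.
by rewrite -mulrN1 ler_wpM2l // cosT_geN1.
Qed.

(** The order of quantifiers serves the iteration: [tau'] and [r'] are determined before [delta'] is
    given, and [delta] and [M] only afterwards. *)
Lemma energy_increment (R : realType) (l : nat) (P : 'I_l -> {poly int})
    (eps tau : R) (r : nat) :
  (forall i, (P i).[0] = 0) -> (forall i, P i != 0) ->
  0 < eps -> 0 < tau -> (0 < r)%N ->
  exists (tau' : R) (r' : nat), [/\ 0 < tau', (0 < r')%N &
  forall delta' : R, 0 < delta' ->
  exists (delta : R) (M : nat), 0 < delta /\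
  forall (T : finType) (w th : T -> R), (forall y, 0 <= w y) -> \sum_y w y <= 1 ->
    (exists n : nat, (0 < n <= M)%N /\
       forall i, - eps < \sum_y w y * cosT ((P i).[n%:Z]%:~R * th y)) \/
    \sum_(y in heavy w th r delta tau) w y + eps / 2
      <= \sum_(y in heavy w th r' delta' tau') w y].
Proof.
move=> P0 PN eps0 tau0 r0.
pose d := \max_i size (P i).
pose J := Num.bound tau^-1.
have [K HK] := @polynomial_recurrence R d (J * l) 8^-1 (ltac:(by rewrite invr_gt0)).
(* With [tau' <= eta], the [l * K] light sums have total mean square below [eps ^+ 2 / 4], whereas
   failure of every [n] forces at least that much. *)
pose eta := eps ^+ 2 / 4 / (2 * (l * K)%N.+1%:R).
have eta0 : 0 < eta by rewrite !divr_gt0 ?exprn_gt0 ?mulr_gt0.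
pose tau' := Num.min tau eta.
have tau'0 : 0 < tau' by rewrite lt_min tau0.
have etaK : (l * K)%:R * (eta + tau') < eps ^+ 2 / 4.
  apply: (@le_lt_trans _ _ ((l * K)%:R * (2 * eta))).
    apply: ler_wpM2l => //; have : tau' <= eta by rewrite ge_min lexx orbT.
    lra.
  have e4 : 0 < eps ^+ 2 / 4 by rewrite divr_gt0 ?exprn_gt0.
  rewrite /eta (_ : _ * _ = eps ^+ 2 / 4 * ((l * K)%:R / (l * K).+1%:R)); last first.
    have : (l * K).+1%:R != 0 :> R by rewrite pnatr_eq0.
    by move: (l * K)%:R (l * K).+1%:R => u v v0; field.
  by rewrite -[X in _ < X]mulr1 ltr_pM2l // ltr_pdivrMr // mul1r ltr_nat.
have [r' [r'0 /dvdnP[m0 rE] HW]] := weyl_common_modulus K P0 PN r0 eta0.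
exists tau', r'; split => // delta' d'0.
have [X [X0 hX]] := HW _ d'0.
(* [B] bounds all polynomial values that occur; the summand [r'] makes it bound the quotient [m0] of
   [r'] by [r] as well. *)
pose B := (r' + \sum_(i < l) \sum_(k < K) \sum_(x < X)
             absz (P i).[(r * (k.+1 * x.+1))%N%:Z])%N.
have BP i (k : 'I_K) (x : 'I_X) : (absz (P i).[(r * (k.+1 * x.+1))%N%:Z] <= B)%N.
  by rewrite /B (bigD1 i) //= (bigD1 k) //= (bigD1 x) //=; lia.
have B0 : 0 < B%:R :> R by rewrite ltr0n /B; lia.
(* This gives both [B * delta < delta'], for nested heavy sets, and [B * (2 * delta) <= 1/8], for
   the clusters. *)
pose delta := Num.min delta' 1 / (16 * B%:R).
have md : 0 < Num.min delta' 1 by rewrite lt_min d'0 ltr01.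
have delta0 : 0 < delta by rewrite divr_gt0 // mulr_gt0.
have Bdelta : B%:R * delta = Num.min delta' 1 / 16.
  by rewrite /delta; field; rewrite gt_eqF.
exists delta, (r * (K * X))%N; split => // T w th w0 w1.
set H := heavy w th r delta tau; set H' := heavy w th r' delta' tau'.
have HH' : H \subset H'.
  apply: sub_heavy => // [|al hal]; first by rewrite ge_min lexx.
  have m00 : (0 < m0)%N by move: r'0; rewrite rE muln_gt0 => /andP[].
  have -> : r'%:R * al = m0%:R * (r%:R * al) by rewrite rE natrM mulrA.
  apply: le_lt_trans (dintMn _ _) _.
  apply: (@lt_le_trans _ _ (m0%:R * delta)); first by rewrite ltr_pM2l // ltr0n.
  apply: (@le_trans _ _ (B%:R * delta)).
    rewrite ler_pM2r // ler_nat /B rE; apply: leq_trans (leq_addr _ _).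
    by rewrite leq_pmulr.
  rewrite Bdelta; have : Num.min delta' 1 <= delta' by rewrite ge_min lexx.
  lra.
have [|small] := leP (\sum_(y in H) w y + eps / 2) (\sum_(y in H') w y); [by right|left].
have HE : \sum_(y in H' :\: H) w y < eps / 2.
  move: small; rewrite (big_setID H) /= (setIidPr HH'); lra.
have [S [cS HS]] := heavy_packing th r tau w0 w1 delta0.
have cardS : (#|S| <= J)%N.
  rewrite -(ler_nat R); apply: (@le_trans _ _ tau^-1).
    by rewrite -[tau^-1]mul1r ler_pdivlMr.
  by apply/ltW/archi_boundP; rewrite invr_ge0 ltW.
pose light (i : 'I_l) (k : 'I_K) (x : 'I_X) :=
  \sum_(y in ~: H') w y * cosT ((P i).[(r * (k.+1 * x.+1))%N%:Z]%:~R * th y).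
have light_mom : \sum_(x < X) \sum_(i < l) \sum_(k < K) light i k x ^+ 2
    <= X%:R * ((l * K)%:R * (eta + tau')).
  rewrite exchange_big /=; under eq_bigr do rewrite exchange_big /=.
  apply: (@le_trans _ _ (\sum_(i < l) \sum_(k < K) X%:R * (eta + tau'))).
    apply: ler_sum => i _; apply: ler_sum => k _.
    apply: (@light_second_moment _ _ _ _ _ _ _ _ _
      (fun x => (P i).[(r * (k.+1 * x.+1))%N%:Z])) => //.
    - exact: ltW.
    - exact: ltW.
    - by move=> al; have := hX i k al; under eq_bigr do rewrite -mulnA.
  rewrite sumr_const card_ord sumr_const card_ord -mulrnA -mulr_natr mulnC.
  by rewrite le_eqVlt; apply/orP; left; apply/eqP; ring.
have [|] := boolP [exists n : 'I_(r * (K * X)).+1, (0 < n)%N &&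
   [forall i, - eps < \sum_y w y * cosT ((P i).[n%:Z]%:~R * th y)]].
  case/existsP => n /andP[n0 /forallP hn]; exists n; split => //.
  by rewrite n0 -ltnS ltn_ord.
rewrite negb_exists => /forallP bad; exfalso.
(* The recurrence time [k] depends on [x], hence the sum over all [k]. Some [i] fails at the
   resulting [n]; the heavy part is nonnegative and the intermediate part exceeds [- eps / 2], so
   the light part is at most [- eps / 2]. *)
have light_big (x : 'I_X) : eps ^+ 2 / 4 <= \sum_(i < l) \sum_(k < K) light i k x ^+ 2.
  have [||k [/andP[k0 kK] hk]] := HK ({s | s \in S} * 'I_l)%type _
     (fun si k => (P si.2).[(r * x.+1 * k)%N%:Z]%:~R * th (val si.1)).
  - by rewrite card_prod card_sig card_ord leq_mul2r cardS orbT.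
  - move=> [s i] /=; split; first by rewrite muln0 P0 mul0r.
    eexists; apply: (@pdeg_horner _ (P i) d (r * x.+1)); apply: leqW.
    exact: (leq_bigmax i).
  case: k k0 kK hk => // k _ kK hk; pose k' := Ordinal kK.
  have nM : (r * (k.+1 * x.+1) < (r * (K * X)).+1)%N.
    by rewrite ltnS leq_mul2l leq_mul ?orbT // ltn_ord.
  have := bad (Ordinal nM); rewrite negb_and /= !muln_gt0 r0 /=.
  rewrite negb_forall => /existsP[i]; rewrite -leNgt => badi.
  rewrite (bigD1 i) //= (bigD1 k') //= -addrA; apply: ler_wpDr.
    by rewrite addr_ge0 ?sumr_ge0 // => *; rewrite ?sumr_ge0 // => *; exact: sqr_ge0.
  have str : 0 <= \sum_(y in H) w y * cosT ((P i).[(r * (k.+1 * x.+1))%N%:Z]%:~R * th y).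
    apply: (structured_sum_ge0 (S := S) (B := B) (delta := delta)) => //.
    - exact: (BP i k' x).
    - rewrite mulrCA Bdelta; have : Num.min delta' 1 <= 1 by rewrite ge_min lexx orbT.
      lra.
    - move=> s sS; have := hk (exist _ s sS, i) => /=.
      by rewrite -mulnA (mulnC x.+1).
  have err := sum_cosT_ge
    (fun y => (P i).[(r * (k.+1 * x.+1))%N%:Z]%:~R * th y) (H' :\: H) w0.
  have split3 : \sum_y w y * cosT ((P i).[(r * (k.+1 * x.+1))%N%:Z]%:~R * th y) =
     \sum_(y in H) w y * cosT ((P i).[(r * (k.+1 * x.+1))%N%:Z]%:~R * th y) +
     \sum_(y in H' :\: H) w y * cosT ((P i).[(r * (k.+1 * x.+1))%N%:Z]%:~R * th y) +
     light i k' x.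
    rewrite (bigID (mem H')) /= (big_setID H) /= (setIidPr HH'); congr (_ + _ + _).
    by rewrite /light; apply: eq_bigl => y; rewrite in_setC.
  have lt : light i k' x <= - (eps / 2).
    by move: badi; rewrite split3; lra.
  nra.
have hsum : X%:R * (eps ^+ 2 / 4) <=
    \sum_(x < X) \sum_(i < l) \sum_(k < K) light i k x ^+ 2.
  by rewrite mulr_natl -[X in _ *+ X]card_ord -sumr_const;
    apply: ler_sum => x _; exact: light_big.
have := le_trans hsum light_mom; rewrite ler_pM2l ?ltr0n //.
by rewrite leNgt etaK.
Qed.

Lemma positive_definite_recurrence_nonzero (R : realType) (l : nat)
    (P : 'I_l -> {poly int}) (eps : R) :
  (forall i, (P i).[0] = 0) -> (forall i, P i != 0) -> 0 < eps ->
  exists M : nat, forall (T : finType) (w th : T -> R),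
    (forall y, 0 <= w y) -> \sum_y w y <= 1 ->
    exists n : nat, (0 < n <= M)%N /\
      forall i, - eps < \sum_y w y * cosT ((P i).[n%:Z]%:~R * th y).
Proof.
move=> P0 PN eps0.
(* [t] counts the rounds still to come. Induction on it passes [tau] and [r] forward and receives
   [delta'] back from the later rounds. *)
have iter t : forall (tau : R) (r : nat), 0 < tau -> (0 < r)%N ->
  exists (delta : R) (M : nat), 0 < delta /\
  forall (T : finType) (w th : T -> R), (forall y, 0 <= w y) -> \sum_y w y <= 1 ->
    (exists n : nat, (0 < n <= M)%N /\
       forall i, - eps < \sum_y w y * cosT ((P i).[n%:Z]%:~R * th y)) \/
    \sum_(y in heavy w th r delta tau) w y + t%:R * (eps / 2) <= 1.
  elim: t => [|t IH] tau r tau0 r0.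
    exists 1, 0%N; split => // T w th w0 w1; right; rewrite mul0r addr0.
    apply: le_trans w1; rewrite [X in _ <= X](bigID (mem (heavy w th r 1 tau))) /=.
    by rewrite lerDl sumr_ge0.
  have [tau' [r' [tau'0 r'0 h]]] := energy_increment P0 PN eps0 tau0 r0.
  have [delta' [M' [d'0 h']]] := IH tau' r' tau'0 r'0.
  have [delta [M [d0 hd]]] := h _ d'0.
  exists delta, (maxn M M'); split => // T w th w0 w1.
  case: (hd T w th w0 w1) => [[n [/andP[n0 nM] hn]]|h1].
    by left; exists n; rewrite n0 leq_max nM.
  case: (h' T w th w0 w1) => [[n [/andP[n0 nM] hn]]|h2].
    by left; exists n; rewrite n0 leq_max nM orbT.
  right; apply: le_trans h2; rewrite -[t.+1]add1n natrD mulrDl mul1r addrA.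
  by rewrite lerD2r.
(* With this many rounds the increments alone exceed the total mass 1. *)
have [delta [M [_ hM]]] := iter (Num.bound (eps / 2)^-1) 1 1%N ltr01 isT.
exists M => T w th w0 w1; case: (hM T w th w0 w1) => // h.
have e2 : 0 < eps / 2 by rewrite divr_gt0.
have : 1 < (Num.bound (eps / 2)^-1)%:R * (eps / 2).
  rewrite -ltr_pdivrMr // mul1r; apply: archi_boundP.
  by rewrite invr_ge0 ltW.
have : 0 <= \sum_(y in heavy w th 1 delta 1) w y by apply: sumr_ge0.
by lra.
Qed.

(* [w] is the spectral measure: [\sum_y w y * cosT (m * th y)] is an arbitrary
   positive definite function of [m], up to limits. *)
Lemma positive_definite_recurrence (R : realType) (l : nat)
    (P : 'I_l -> {poly int}) (eps : R) :
  (forall i, (P i).[0] = 0) -> 0 < eps ->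
  exists M : nat, forall (T : finType) (w th : T -> R),
    (forall y, 0 <= w y) -> \sum_y w y <= 1 ->
    exists n : nat, (0 < n <= M)%N /\
      forall i, - eps < \sum_y w y * cosT ((P i).[n%:Z]%:~R * th y).
Proof.
(* A zero polynomial is replaced by ['X]: its own sum is the total mass, which is nonnegative, so
   every [n] suits it. *)
move=> P0 eps0; pose P' i := if P i == 0 then 'X else P i.
have [i|i|M hM] := @positive_definite_recurrence_nonzero R l P' eps _ _ eps0.
- by rewrite /P'; case: ifP => _; rewrite ?hornerX.
- by rewrite /P'; case: ifPn => // _; rewrite polyX_eq0.
exists M => T w th w0 w1; have [n [nM hn]] := hM T w th w0 w1.
exists n; split => // i; have := hn i; rewrite /P'; case: eqP => // -> _.
apply: lt_le_trans (_ : 0 <= _); first by rewrite oppr_lt0.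
by apply: sumr_ge0 => y _; rewrite horner0 mul0r cosT0 mulr1.
Qed.

(** * Correlations of a set of integers *)

Lemma card_sub_int_interval (N : nat) (A : {fset int}) :
  A `<=` int_interval N -> #|` A| = (\sum_(a < N) (a.+1%:Z \in A))%N.
Proof.
move=> AN.
have -> : #|` A| = size [seq x <- [seq n.+1%:Z | n <- iota 0 N] | x \in A].
  apply/perm_size/uniq_perm; first exact: fset_uniq.
    by rewrite filter_uniq // map_inj_uniq ?iota_uniq // => x y [].
  move=> x; rewrite mem_filter; case xA : (x \in A) => //=.
  have := fsubsetP AN x xA; rewrite mem_int_interval; case: x xA => // -[|n] //= _ nN.
  by rewrite mem_map ?mem_iota //= => u v [].
rewrite size_filter count_map -sum1_count.
rewrite -(big_mkord xpredT (fun a => (a.+1%:Z \in A) : nat)).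
by rewrite big_mkcond /= /index_iota subn0; apply: eq_bigr => a _; case: (_ \in _).
Qed.

(** * Fourier analysis modulo [N] *)

Lemma sinT_cosT (R : realType) (x : R) : sinT x = cosT (x - 4^-1).
Proof.
by rewrite /sinT /cosT -cosBpihalf; congr cos; field.
Qed.

(** Orthogonality of characters: if [N] does not divide [k], the telescoped sum vanishes by
    periodicity while the factor [sin(pi k / N)] is nonzero. *)
Lemma sum_cosT_root (R : realType) (N : nat) (k : int) : (0 < N)%N ->
  \sum_(x < N) cosT (k%:~R / N%:R * x%:R) = (N%:Z %| k)%Z%:R * N%:R :> R.
Proof.
move=> N0; have NR : N%:R != 0 :> R by rewrite pnatr_eq0 -lt0n.
have [/dvdzP[q ->]|kN] := boolP (N%:Z %| k)%Z.
  rewrite mul1r -[RHS](_ : \sum_(x < N) 1 = _); last by rewrite sumr_const card_ord.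
  apply: eq_bigr => x _; rewrite intrM -pmulrn mulfK //.
  rewrite (_ : q%:~R * x%:R = 0 + (q * x%:Z)%:~R); last by rewrite add0r intrM -pmulrn.
  by rewrite cosTDz cosT0.
rewrite mul0r; apply/eqP.
have h := cosT_sum (k%:~R / N%:R : R) 0 N.
have e1 : sinT (k%:~R / N%:R * N%:R + 0 - k%:~R / N%:R / 2) =
    sinT (0 - k%:~R / N%:R / 2) :> R.
  rewrite !sinT_cosT divfK // -[RHS](cosTDz _ k); congr cosT; ring.
rewrite e1 subrr in h.
have : 2 * sin (pi * (k%:~R / N%:R)) != 0 :> R.
  rewrite mulf_neq0 ?pnatr_eq0 // -normr_gt0 sin_pi_dint.
  have d0 := dint_ge0 (k%:~R / N%:R : R); have d1 := dint_le_half (k%:~R / N%:R : R).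
  have dN : dint (k%:~R / N%:R : R) != 0.
    apply: contra kN; rewrite /dint normr_eq0 subr_eq0 => /eqP E.
    apply/dvdzP; exists (Num.floor (k%:~R / N%:R + 2^-1 : R)).
    apply/eqP; rewrite -(eqr_int R) intrM -E -pmulrn divfK //.
  have p0 := pi_gt0 R.
  apply: sin_gt0_pi; apply/andP; split.
    by rewrite mulr_gt0 // lt_neqAle eq_sym dN.
  by nra.
move/eqP: h; rewrite mulf_eq0 => /orP[->//|/eqP h _].
by apply/eqP; rewrite -[RHS]h; apply: eq_bigr => x _; rewrite addr0.
Qed.

(** The squared modulus of the Fourier coefficient of [F] at [x], normalised by [1 / N], written as
    a real double sum. *)
Definition spectral_weight {R : realType} (N : nat) (F : 'I_N -> R) (x : nat) : R :=
  (\sum_a \sum_b F a * F b * cosT ((a%:Z - b%:Z)%:~R / N%:R * x%:R)) / N%:R ^+ 2.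

Lemma spectral_weight_ge0 (R : realType) (N : nat) (F : 'I_N -> R) (x : nat) :
  0 <= spectral_weight F x.
Proof.
rewrite /spectral_weight divr_ge0 ?sqr_ge0 //.
apply: le_trans (sqr_ge0 (\sum_a F a * cosT (a%:R / N%:R * x%:R))) _.
apply: le_trans (sqr_sum_cosT_le _ _) _.
rewrite le_eqVlt; apply/orP; left; apply/eqP.
apply: eq_bigr => a _; apply: eq_bigr => b _; congr (_ * cosT _).
by rewrite intrB -!pmulrn; ring.
Qed.

Lemma spectral_weight0 (R : realType) (N : nat) (F : 'I_N -> R) :
  spectral_weight F 0 = ((\sum_a F a) / N%:R) ^+ 2.
Proof.
rewrite /spectral_weight expr_div_n; congr (_ / _).
rewrite expr2 mulr_suml; apply: eq_bigr => a _; rewrite mulr_sumr.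
by apply: eq_bigr => b _; rewrite mulr0 cosT0 mulr1.
Qed.

(** The product formula for cosines and orthogonality give the average of the correlations at [m]
    and [- m]; exchanging [a] and [b] shows that these agree. *)
Lemma spectral_weight_correlation (R : realType) (N : nat) (F : 'I_N -> R) (m : int) :
  (0 < N)%N ->
  \sum_(x < N) spectral_weight F x * cosT (m%:~R * (x%:R / N%:R)) =
  (\sum_a \sum_b F a * F b * (N%:Z %| a%:Z - b%:Z - m)%Z%:R) / N%:R.
Proof.
move=> N0; have NR : N%:R != 0 :> R by rewrite pnatr_eq0 -lt0n.
pose D (k : int) : R := (N%:Z %| k)%Z%:R.
have -> : \sum_(x < N) spectral_weight F x * cosT (m%:~R * (x%:R / N%:R)) =
  (\sum_a \sum_b F a * F b *
     ((D (a%:Z - b%:Z - m) + D (a%:Z - b%:Z + m)) * N%:R / 2)) / N%:R ^+ 2.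
  under eq_bigr do rewrite /spectral_weight mulrAC mulr_suml.
  rewrite -mulr_suml exchange_big /=; congr (_ / _); apply: eq_bigr => a _.
  under eq_bigr do rewrite mulr_suml.
  rewrite exchange_big /=; apply: eq_bigr => b _.
  under eq_bigr do rewrite -(mulrA (F a * F b)) cosTM.
  rewrite -mulr_sumr -mulr_suml big_split /=; congr (_ * (_ / _)).
  rewrite mulrDl -!sum_cosT_root //; congr (_ + _); apply: eq_bigr => x _; congr cosT.
    by rewrite !intrB; ring.
  by rewrite !intrD; ring.
have -> : \sum_a \sum_b F a * F b *
      ((D (a%:Z - b%:Z - m) + D (a%:Z - b%:Z + m)) * N%:R / 2) =
   (\sum_a \sum_b F a * F b * D (a%:Z - b%:Z - m) +
    \sum_a \sum_b F a * F b * D (a%:Z - b%:Z + m)) * (N%:R / 2).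
  rewrite -big_split mulr_suml; apply: eq_bigr => a _ /=.
  by rewrite -big_split mulr_suml; apply: eq_bigr => b _ /=; ring.
have -> : \sum_a \sum_b F a * F b * D (a%:Z - b%:Z + m) =
    \sum_a \sum_b F a * F b * D (a%:Z - b%:Z - m).
  rewrite exchange_big /=; apply: eq_bigr => a _; apply: eq_bigr => b _.
  rewrite [F b * _]mulrC /D; congr (_ * _%:R).
  congr nat_of_bool; rewrite -[RHS]rpredN; congr (_ %| _)%Z; ring.
by rewrite -/(D _); move: (\sum_a _) => s; field.
Qed.

Lemma eq0_of_mulz_small (q : int) (N : nat) : `|q * N%:Z| < N%:Z -> q = 0.
Proof.
have [//|q0] := eqVneq q 0.
rewrite normrM (ger0_norm (_ : 0 <= N%:Z)) // ltNge ler_peMl //.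
by rewrite -gtz0_ge1 normr_gt0.
Qed.

Lemma sum_dvdz_sub_le1 (R : realType) (N : nat) (j : int) (F : 'I_N -> R) :
  (forall b, 0 <= F b <= 1) ->
  \sum_(b < N) F b * (N%:Z %| j - b%:Z)%Z%:R <= 1.
Proof.
move=> F01.
have [b0 hb|h] := pickP (fun b : 'I_N => (N%:Z %| j - b%:Z)%Z); last first.
  by rewrite big1 // => b _; rewrite h mulr0.
rewrite (bigD1 b0) //= big1 ?addr0 ?hb ?mulr1.
  by case/andP: (F01 b0).
move=> b bb0; case hb' : (_ %| _)%Z; rewrite ?mulr0 // mulr1.
suff E : b = b0 by rewrite E eqxx in bb0.
apply/val_inj => /=; have := ltn_ord b; have := ltn_ord b0.
have /dvdzP[q qE] : (N%:Z %| b%:Z - b0%:Z)%Z.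
  have -> : b%:Z - b0%:Z = (j - b0%:Z) - (j - b%:Z) by ring.
  exact: rpredB.
move=> h1 h2; have q0 : q = 0 by apply: (@eq0_of_mulz_small q N); rewrite -qE; lia.
by move: qE; rewrite q0 mul0r; lia.
Qed.

Lemma sum_ltn_ord (N k : nat) : (\sum_(a < N) (a < k)%N <= k)%N.
Proof.
suff : (\sum_(a < N) (a < k)%N <= minn N k)%N by lia.
elim: N => [|N IH]; first by rewrite big_ord0.
rewrite big_ord_recr /=; apply: leq_trans (leq_add IH (leqnn _)) _.
by case: ltnP; lia.
Qed.

Lemma sum_out_of_range (N : nat) (m : int) :
  (\sum_(a < N) ~~ (0 <= a%:Z - m < N%:Z)%R <= absz m)%N.
Proof.
case: (lerP 0 m) => m0.
  apply: leq_trans (sum_ltn_ord N (absz m)); apply: leq_sum => a _.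
  by have := ltn_ord a; lia.
(* For negative [m] the last indices leave the range; reversal turns them into the first ones. *)
apply: leq_trans (sum_ltn_ord N (absz m)); rewrite (reindex_inj rev_ord_inj) /=.
by apply: leq_sum => a _; have := ltn_ord a; lia.
Qed.

(** If [a - m] stays in range, congruence forces [b = a - m], a genuine element of the intersection.
    At most [|m|] values of [a] wrap around, each with at most one [b]. *)
Lemma cyclic_correlation_le (R : realType) (N : nat) (A : {fset int}) (m : int) :
  A `<=` int_interval N ->
  \sum_(a < N) \sum_(b < N) (a.+1%:Z \in A)%:R * (b.+1%:Z \in A)%:R
     * (N%:Z %| a%:Z - b%:Z - m)%Z%:R
  <= (#|` A `&` shift A m|)%:R + (absz m)%:R :> R.
Proof.
move=> AN.
have AN' : A `&` shift A m `<=` int_interval N.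
  by apply: fsubset_trans AN; exact: fsubsetIl.
rewrite (card_sub_int_interval AN').
apply: (@le_trans _ _ (\sum_(a < N) ((a.+1%:Z \in A `&` shift A m)%:R +
    (~~ (0 <= a%:Z - m < N%:Z))%:R))); last first.
  rewrite big_split /= -!natr_sum -!natrD ler_nat leq_add2l.
  exact: sum_out_of_range.
apply: ler_sum => a _.
have E b : (N%:Z %| a%:Z - b%:Z - m)%Z = (N%:Z %| (a%:Z - m) - b%:Z)%Z.
  by congr (_ %| _)%Z; ring.
under eq_bigr do rewrite -mulrA E.
rewrite -mulr_sumr.
have le1 : \sum_(b < N) (b.+1%:Z \in A)%:R * (N%:Z %| a%:Z - m - b%:Z)%Z%:R <= 1 :> R.
  by apply: sum_dvdz_sub_le1 => b; case: (_ \in A); rewrite ?lexx ler01.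
case: (boolP (0 <= a%:Z - m < N%:Z)) => [rng|_]; last first.
  apply: (@le_trans _ _ 1); last by rewrite lerDr.
  apply: le_trans le1; apply: ler_piMl; last by case: (_ \in A).
  by apply: sumr_ge0 => b _; rewrite mulr_ge0.
rewrite addr0 inE mem_shift.
case aA : (a.+1%:Z \in A); last by rewrite mul0r.
rewrite mul1r andTb.
case amA : (a.+1%:Z - m \in A); first exact: le1.
rewrite big1 // => b _; case bA : (b.+1%:Z \in A); rewrite ?mul0r // mul1r.
case/boolP: (_ %| _)%Z => // /dvdzP[q qE].
suff bE : b%:Z = a%:Z - m.
  by move: amA; rewrite (_ : a.+1%:Z - m = b.+1%:Z) ?bA //; lia.
have bN := ltn_ord b.
have q0 : q = 0 by apply: (@eq0_of_mulz_small q N); rewrite -qE; lia.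
by move: qE; rewrite q0 mul0r; lia.
Qed.

Theorem corollary1p3 (R : realType) (l : nat) (P : 'I_l -> {poly int})
    (P0 : forall i : 'I_l, (P i).[0] = 0) :
  forall eps : R, 0 < eps ->
  exists N0 : nat, forall N : nat, (0 < N)%N -> (N0 <= N)%N ->
  forall A : {fset int}, A `<=` int_interval N ->
  exists n : nat, (0 < n)%N /\
    forall i : 'I_l,
      (#|` A `&` shift A (P i).[n%:Z]|)%:R / N%:R
        > ((#|` A|)%:R / N%:R) ^+ 2 - eps.
Proof.
move=> eps eps0; have e2 : 0 < eps / 2 by rewrite divr_gt0.
have [M hM] := positive_definite_recurrence P0 e2.
(* [B] bounds every possible shift, so that for large [N] wrapping around costs at most
   [eps / 2]. *)
pose B := (\sum_(n < M.+1) \sum_(i < l) absz (P i).[n%:Z])%N.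
exists (Num.bound (B%:R / (eps / 2))) => -[//|N'] _; set N := N'.+1 => NN0 A AN.
have NR : 0 < N%:R :> R by rewrite ltr0n.
have BN : B%:R / N%:R <= eps / 2.
  rewrite ler_pdivrMr // mulrC -ler_pdivrMr //.
  by apply: le_trans (ltW (archi_boundP _)) _; rewrite ?ler_nat // divr_ge0 // ltW.
pose F (a : 'I_N) : R := (a.+1%:Z \in A)%:R.
pose W (x : 'I_N) : R := spectral_weight F x.
(* The zero frequency is removed, since it carries the main term; the recurrence bounds what remains
   from below. *)
pose w (x : 'I_N) : R := if x == ord0 then 0 else W x.
have W0 x : 0 <= W x by exact: spectral_weight_ge0.
have w0 x : 0 <= w x by rewrite /w; case: ifP.
have w1 : \sum_x w x <= 1.
  apply: (@le_trans _ _ (\sum_x W x)).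
    by apply: ler_sum => x _; rewrite /w; case: ifP.
  (* The total mass is the correlation at [m = 0], where each [a] is matched with at most one
     [b]. *)
  have := spectral_weight_correlation F 0 (isT : (0 < N)%N).
  under eq_bigr do rewrite mul0r cosT0 mulr1.
  rewrite -/(\sum_x W x) => ->; rewrite ler_pdivrMr // mul1r.
  apply: (@le_trans _ _ (\sum_(a < N) 1)); last by rewrite sumr_const card_ord.
  apply: ler_sum => a _.
  apply: le_trans (_ : _ <= \sum_b F b * (N%:Z %| a%:Z - b%:Z)%Z%:R) _.
    apply: ler_sum => b _; rewrite subr0 -mulrA; apply: ler_piMl; rewrite ?mulr_ge0 //.
    by rewrite /F; case: (_ \in A).
  by apply: sum_dvdz_sub_le1 => b; rewrite /F; case: (_ \in A); rewrite ?lexx ler01.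
have [n [/andP[n0 nM] hn]] := hM 'I_N w (fun x => x%:R / N%:R) w0 w1.
exists n; split => // i; set m := (P i).[n%:Z].
have mB : (absz m <= B)%N.
  have nM' : (n < M.+1)%N by [].
  by rewrite /B (bigD1 (Ordinal nM')) //= (bigD1 i) //= -/m; lia.
have mBN : (absz m)%:R / N%:R <= eps / 2 :> R.
  by apply: le_trans BN; rewrite ler_pM2r ?invr_gt0 // ler_nat.
have corr := spectral_weight_correlation F m (isT : (0 < N)%N).
have cyc := @cyclic_correlation_le R N A m AN.
have := hn i; rewrite -/m => hi.
have E : \sum_(x < N) spectral_weight F x * cosT (m%:~R * (x%:R / N%:R)) =
   ((#|` A|)%:R / N%:R) ^+ 2 + \sum_(x < N) w x * cosT (m%:~R * (x%:R / N%:R)).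
  rewrite (bigD1 ord0) //=; congr (_ + _); last first.
    rewrite [RHS](bigD1 ord0) //= /w eqxx mul0r add0r.
    by apply: eq_bigr => x /negbTE xN; rewrite xN.
  rewrite mul0r mulr0 cosT0 mulr1 spectral_weight0 (card_sub_int_interval AN).
  by rewrite natr_sum.
have : (\sum_(a < N) \sum_(b < N) F a * F b * (N%:Z %| a%:Z - b%:Z - m)%Z%:R) / N%:R
   <= (#|` A `&` shift A m|)%:R / N%:R + (absz m)%:R / N%:R.
  by rewrite -mulrDl ler_pM2r ?invr_gt0.
rewrite -corr E; lra.
Qed.
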